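(* Let $n\ge5$ and $S=\{1,s\}\subset\mathbb Z_n$ with $s$ an integer, $1<s<n/2$, and let $\mathbb K$ be a field of characteristic $0$. (1) If $s=2$, then $H_0^{\mathrm{path}}(\vec C_n^S;\mathbb K)\cong\mathbb K$, $H_1^{\mathrm{path}}(\vec C_n^S;\mathbb K)\cong\mathbb K$, and $H_m^{\mathrm{path}}(\vec C_n^S;\mathbb K)=0$ for $m\ge2$. (2) If $s\ne2$, then $H_0^{\mathrm{path}}\cong\mathbb K$, $H_1^{\mathrm{path}}\cong\mathbb K^2$, $H_2^{\mathrm{path}}\cong\mathbb K$, and $H_m^{\mathrm{path}}=0$ for $m\ge3$.
   Context: GLMY path complex over a field $\mathbb K$ of characteristic $0$: elementary paths $e_{v_0\cdots v_n}$, boundary $\partial e_{v_0\cdots v_n}=\sum_{j}(-1)^j e_{v_0\cdots\widehat{v_j}\cdots v_n}$, paths with two equal consecutive vertices set to $0$; $A_n(G)$ = span of paths along arrows of $G$; $\Omega_0=A_0$, $\Omega_1=A_1$, $\Omega_n=\{u\in A_n:\partial u\in A_{n-1}\}$; $H^{\mathrm{path}}_m$ is the homology of $(\Omega_*,\partial)$. The circulant digraph $\vec{C}_n^S$ has vertex set $\mathbb Z_n$ and an arrow $a\to a+s$ for each $a\in\mathbb Z_n$, $s\in S$. *)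

(* Defs.v *)
From HB Require Import structures.
From mathcomp Require Import all_boot all_order all_algebra.
Set Implicit Arguments. Unset Strict Implicit. Unset Printing Implicit Defensive.
Import Order.TTheory GRing.Theory Num.Theory.
Local Open Scope ring_scope.

Section PathHomology.
Variable K : fieldType.
Variable n : nat.
Variable arrow : 'I_n -> 'I_n -> bool.

Definition epath (m : nat) := {ffun 'I_m.+1 -> 'I_n}.

Definition chain (m : nat) := {ffun epath m -> K^o}.

Definition epath_vec (m : nat) (v : epath m) : chain m :=
  [ffun w => (w == v)%:R].

Definition regular (m : nat) (v : epath m) : bool :=
  [forall i : 'I_m, v (widen_ord (leqnSn m) i) != v (lift ord0 i)].

Definition allowed (m : nat) (v : epath m) : bool :=
  [forall i : 'I_m, arrow (v (widen_ord (leqnSn m) i)) (v (lift ord0 i))].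

Definition delv (m : nat) (j : 'I_m.+2) (v : epath m.+1) : epath m :=
  [ffun i => v (lift j i)].

(* boundary on the regular path complex: d e_v = sum_j (-1)^j e_{v without j},
   non-regular paths being set to 0 *)
Definition bdry_fun (m : nat) (u : chain m.+1) : chain m :=
  [ffun w => if regular w then
               \sum_(v : epath m.+1) \sum_(j < m.+2)
                  (if delv j v == w then (-1) ^+ j * u v else 0)
             else 0].

Definition bdry (m : nat) : 'Hom(chain m.+1, chain m) := linfun (@bdry_fun m).

Definition Aspace (m : nat) : {vspace chain m} :=
  <<[seq epath_vec v | v <- enum [pred v : epath m | allowed v]]>>%VS.

Definition Omega (m : nat) : {vspace chain m} :=
  match m with
  | 0 => Aspace 0
  | m'.+1 => (Aspace m'.+1 :&: (bdry m' @^-1: Aspace m'))%VS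
  end.

Definition cycles (m : nat) : {vspace chain m} :=
  match m with
  | 0 => Omega 0
  | m'.+1 => (Omega m'.+1 :&: lker (bdry m'))%VS
  end.

Definition boundaries (m : nat) : {vspace chain m} := (bdry m @: Omega m.+1)%VS.

(* dim_K H_m^path = dim Z_m - dim B_m (B_m is a subspace of Z_m) *)
Definition path_betti (m : nat) : nat := (\dim (cycles m) - \dim (boundaries m))%N.

End PathHomology.

Definition circ_arrow (n : nat) (S : seq nat) (a b : 'I_n) : bool :=
  has (fun s => (val b == (val a + s) %% n)%N) S.

(* Main.v *)
(* The faces of an allowed path that fail to be allowed come from merging two
consecutive steps into a step outside {1, s}. Asking their coefficients to vanish
in the boundary of u in Omega kills u on words with two equal adjacent steps whose sum
is not a step, and makes u antisymmetric under swapping adjacent steps 1 and s.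

If s <> 2, a word in {1, s} with at least three letters is thereby killed, and Omega_2 has
basis the n squares e_(a; 1, s) - e_(a; s, 1), where (a; d) starts at a with steps d.
The boundary of sum_a c_a (square a) vanishes iff c is constant, so dim Z_2 = 1.

If s = 2, only 1 + 1 is again a step, so a surviving word contains at most one 2 and
dim Omega_m <= 2 n for m >= 1. The paths e_(a; 1, ..., 1) lie in Omega, and their
boundaries are independent since only the face (a; 2, 1, ..., 1) of each starts with
a step 2; hence every boundary map in degree at least 2 has rank at least n, which
leaves no room for homology in degrees at least 2. Degree 1 is detected by the cocycle
measuring the size of a step, whose value n on sum_a e_(a; 1) is nonzero in
characteristic 0. *)
Require Import Defs.
From HB Require Import structures.
From mathcomp Require Import all_boot all_order all_algebra ssrAC zify.

Set Implicit Arguments. Unset Strict Implicit. Unset Printing Implicit Defensive.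
Import Order.TTheory GRing.Theory Num.Theory.
Local Open Scope ring_scope.

(** * Dimension bounds by evaluation at chosen coordinates *)

Section Evaluation.
Variables (K : fieldType) (T I : finType) (f : I -> T).

Definition eval_at (u : {ffun T -> K^o}) : {ffun I -> K^o} := [ffun i => u (f i)].

Lemma eval_at_is_linear : linear eval_at.
Proof. by move=> a u v; apply/ffunP=> i; rewrite !ffunE. Qed.

HB.instance Definition _ :=
  GRing.isLinear.Build K {ffun T -> K^o} {ffun I -> K^o} _ eval_at eval_at_is_linear.

Lemma dimv_ffun : \dim {: {ffun I -> K^o}} = #|I|.
Proof. by rewrite dimvf /dim /= muln1. Qed.

(** Evaluation at the points [f i] has trivial kernel on [U], so it embeds [U] in the functions on
    [I]. *)
Lemma dim_le_eval (U : {vspace {ffun T -> K^o}}) :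
  (forall u, u \in U -> (forall i, u (f i) = 0) -> u = 0) -> (\dim U <= #|I|)%N.
Proof.
move=> injU; have ker0: (U :&: lker (linfun eval_at) = 0)%VS.
  apply/eqP; rewrite -subv0; apply/subvP=> u.
  rewrite memv_cap memv_ker lfunE memv0 => /andP[uU /eqP/ffunP u0].
  by apply/eqP/injU=> // i; have := u0 i; rewrite !ffunE.
by rewrite -(limg_dim_eq ker0) -dimv_ffun dimvS ?subvf.
Qed.

(** Evaluation maps [g i] to [c] times the i-th unit vector, so it is onto from [U]. The scalar [c]
    leaves room for the sign of a face. *)
Lemma dim_ge_eval (U : {vspace {ffun T -> K^o}}) (g : I -> {ffun T -> K^o}) (c : K) :
    c != 0 -> (forall i, g i \in U) ->
    (forall i k, g i (f k) = c * (i == k)%:R) -> (#|I| <= \dim U)%N.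
Proof.
move=> c0 gU gE.
rewrite -dimv_ffun -(limg_ker_dim (linfun eval_at) U).
suff <-: (linfun eval_at @: U)%VS = fullv by rewrite leq_addl.
apply/eqP; rewrite eqEsubv subvf; apply/subvP=> h _.
have -> : h = linfun eval_at (\sum_i (c^-1 * h i) *: g i).
  rewrite lfunE; apply/ffunP=> k; rewrite !ffunE sum_ffunE (bigD1 k) //= ffunE gE eqxx.
  rewrite mulr1 big1 ?addr0 => [|i /negPf ik]; last by rewrite ffunE gE ik mulr0 scaler0.
  by rewrite /GRing.scale /= mulrAC mulVf // mul1r.
by apply: memv_img; apply: memv_suml => i _; apply: memvZ.
Qed.

End Evaluation.

(** * The path complex of an arbitrary digraph *)

Section PathComplex.
Variables (K : fieldType) (n : nat) (arrow : 'I_n -> 'I_n -> bool).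

(** [bdry] is the [linfun] of this function, and linearity is what lets [lfunE] unfold it. *)
Lemma bdry_fun_is_linear m : linear (@bdry_fun K n m).
Proof.
move=> a u v; apply/ffunP=> w; rewrite !ffunE; case: ifP => _; last by rewrite scaler0 addr0.
rewrite scaler_sumr -big_split; apply: eq_bigr => x _ /=.
rewrite scaler_sumr -big_split; apply: eq_bigr => j _ /=.
by case: ifP => _; rewrite ?scaler0 ?addr0 // !ffunE mulrDr scalerAr.
Qed.

HB.instance Definition _ m :=
  GRing.isLinear.Build K (chain K n m.+1) (chain K n m) _ (@bdry_fun K n m)
    (bdry_fun_is_linear (m := m)).

Lemma bdryE m (u : chain K n m.+1) w : regular w ->
  bdry K n m u w =
    \sum_(v : epath n m.+1) \sum_(j < m.+2) (if delv j v == w then (-1) ^+ j * u v else 0).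
Proof. by move=> rw; rewrite lfunE /= ffunE rw. Qed.

Lemma bdry_epath m (v : epath n m.+1) : (forall j, regular (delv j v)) ->
  bdry K n m (epath_vec K v) = \sum_(j < m.+2) (-1) ^+ j *: epath_vec K (delv j v).
Proof.
move=> rv; apply/ffunP=> w; rewrite lfunE /= ffunE sum_ffunE.
case: ifP => rw; last first.
  rewrite big1 // => j _; rewrite !ffunE; case: eqP => [wE|]; rewrite ?scaler0 //.
  by rewrite wE rv in rw.
rewrite (bigD1 v) //= [X in _ + X]big1 ?addr0 => [|x /negPf xv]; last first.
  by apply: big1 => j _; rewrite ffunE xv mulr0; case: ifP.
apply: eq_bigr => j _; rewrite !ffunE eqxx mulr1 eq_sym.
by case: eqP; rewrite ?scaler0 // /GRing.scale /= mulr1.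
Qed.

Lemma chain_sum m (u : chain K n m) : u = \sum_v u v *: epath_vec K v.
Proof.
apply/ffunP=> w; rewrite sum_ffunE (bigD1 w) //= big1 ?addr0 => [|v /negPf vw]; last first.
  by rewrite !ffunE eq_sym vw scaler0.
by rewrite !ffunE eqxx /GRing.scale /= mulr1.
Qed.

Lemma AspaceP m (u : chain K n m) :
  reflect (forall v, ~~ allowed arrow v -> u v = 0) (u \in Aspace K arrow m).
Proof.
apply: (iffP idP) => [uA v nav | u0].
  (* The coordinate at a path that is not allowed is a linear form vanishing on every spanning
     vector. *)
  pose k := linfun (@eval_at K _ unit (fun _ => v)).
  suff /subvP/(_ u uA) : (Aspace K arrow m <= lker k)%VS.
    by rewrite memv_ker lfunE => /eqP/ffunP/(_ tt); rewrite !ffunE.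
  apply/span_subvP => _ /mapP[w + ->]; rewrite mem_enum inE => aw.
  rewrite memv_ker lfunE; apply/eqP/ffunP=> -[]; rewrite !ffunE.
  by case: eqP => // vw; rewrite vw aw in nav.
rewrite (chain_sum u); apply: memv_suml => v _.
case av : (allowed arrow v); last by rewrite u0 ?av // scale0r mem0v.
by apply: memvZ; apply: memv_span; apply/mapP; exists v; rewrite ?mem_enum.
Qed.

Lemma epath_vec_Aspace m (v : epath n m) : allowed arrow v -> epath_vec K v \in Aspace K arrow m.
Proof.
by move=> av; apply/AspaceP=> w naw; rewrite ffunE; case: eqP => // vw; rewrite vw av in naw.
Qed.

Lemma memv_OmegaS m (u : chain K n m.+1) :
  (u \in Omega K arrow m.+1) =
  (u \in Aspace K arrow m.+1) && (bdry K n m u \in Aspace K arrow m).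
Proof. by rewrite /= memv_cap memv_preim. Qed.

Lemma Aspace0 : Aspace K arrow 0 = fullv.
Proof.
apply/eqP; rewrite eqEsubv subvf; apply/subvP=> u _; apply/AspaceP=> v /negP[].
by apply/forallP=> -[].
Qed.

Lemma Omega1 : Omega K arrow 1 = Aspace K arrow 1.
Proof.
by apply/vspaceP=> u; rewrite memv_OmegaS Aspace0 memvf andbT.
Qed.

(** Rank-nullity for the boundary restricted to Omega; all Betti numbers in positive degree are
    computed through it. *)
Lemma dim_cycles m :
  (\dim (cycles K arrow m.+1) + \dim (boundaries K arrow m) = \dim (Omega K arrow m.+1))%N.
Proof. exact: limg_ker_dim. Qed.

Lemma dim_Omega0 : \dim (Omega K arrow 0) = n.
Proof. by rewrite /= Aspace0 dimv_ffun card_ffun !card_ord expn1. Qed.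

End PathComplex.

(** * Paths as vertex sequences and as words of steps *)

Lemma bump_ltn j i : (i < j)%N -> bump j i = i.
Proof. by rewrite /bump ltnNge => /negPf->. Qed.

Lemma bump_leq j i : (j <= i)%N -> bump j i = i.+1.
Proof. by rewrite /bump => ->. Qed.

Section Vertices.
Variable N : nat.
Notation n := N.+1.

(** Indexing by natural numbers avoids ordinals of varying type; an index above [m] falls back to
    position 0 through [inord]. *)
Definition vertex m (v : epath n m) (k : nat) : nat := v (inord k).

Lemma vertex_inj m (v w : epath n m) :
  (forall k, (k <= m)%N -> vertex v k = vertex w k) -> v = w.
Proof.
move=> vw; apply/ffunP=> i; apply: val_inj.
by have /= := vw i (ltn_ord i); rewrite /vertex inord_val.
Qed.

Lemma vertex_delv m (v : epath n m.+1) (j : 'I_m.+2) k :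
  (k <= m)%N -> vertex (delv j v) k = vertex v (bump j k).
Proof.
move=> km; rewrite /vertex ffunE; congr (nat_of_ord (v _)).
apply: val_inj; rewrite /= !inordK //; rewrite /bump; lia.
Qed.

Lemma ltn_vertex m (v : epath n m) k : (vertex v k < n)%N.
Proof. exact: ltn_ord. Qed.

Let widen_inord m (i : 'I_m) : widen_ord (leqnSn m) i = inord i.
Proof. by apply: val_inj; rewrite /= inordK // ltnW // ltnS. Qed.

Let lift_inord m (i : 'I_m) : lift ord0 i = inord i.+1.
Proof. by apply: val_inj; rewrite /= inordK // ltnS. Qed.

Lemma allowedP (arrow : 'I_n -> 'I_n -> bool) m (v : epath n m) :
  reflect (forall k, (k < m)%N -> arrow (v (inord k)) (v (inord k.+1)))
          (allowed arrow v).
Proof.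
apply: (iffP forallP) => [av k km | av i].
  by have := av (Ordinal km); rewrite widen_inord lift_inord.
by rewrite widen_inord lift_inord av.
Qed.

Lemma regularP m (v : epath n m) :
  reflect (forall k, (k < m)%N -> vertex v k <> vertex v k.+1) (regular v).
Proof.
apply: (iffP forallP) => [rv k km /val_inj/eqP | rv i].
  by have := rv (Ordinal km); rewrite widen_inord lift_inord => /negPf->.
rewrite widen_inord lift_inord; apply/eqP => e.
by apply: (rv i (ltn_ord i)); rewrite /vertex e.
Qed.

(** The start [a] is a natural number reduced mod n by [inZp], so that faces can start at [a + x]
    without explicit reduction. *)
Definition step_path m (a : nat) (d : seq nat) : epath n m :=
  [ffun i : 'I_m.+1 => inZp (a + sumn (take i d))].

Lemma vertex_step_path m a d k :
  (k <= m)%N -> vertex (step_path m a d) k = ((a + sumn (take k d)) %% n)%N.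
Proof. by move=> km; rewrite /vertex ffunE /= inordK. Qed.

Lemma sumn_takeS d k : sumn (take k.+1 d) = (sumn (take k d) + nth 0%N d k)%N.
Proof.
elim: d k => [|x d IHd] [|k] //=; rewrite ?take0 ?addn0 ?add0n //.
by rewrite IHd addnA.
Qed.

Lemma vertex_step_pathS m a d k : (k < m)%N ->
  vertex (step_path m a d) k.+1 = ((vertex (step_path m a d) k + nth 0%N d k) %% n)%N.
Proof.
by move=> km; rewrite !vertex_step_path ?(ltnW km) // modnDml sumn_takeS addnA.
Qed.

Lemma eq_modnDl_small p x y : (x < n)%N -> (y < n)%N ->
  ((p + x) %% n = (p + y) %% n)%N -> x = y.
Proof. by move=> xn yn /eqP; rewrite eqn_modDl !modn_small // => /eqP. Qed.

End Vertices.

(** * Allowed paths of the circulant digraph *)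

Section Circulant.
Variables (K : fieldType) (N s : nat).
Notation n := N.+1.
Hypotheses (s_gt1 : (1 < s)%N) (s_lt : (s.*2 < n)%N).
Notation arrow := (@circ_arrow n [:: 1%N; s]).
Notation steps := [:: 1%N; s].

Lemma allowed_stepP m (v : epath n m) :
  reflect (forall k, (k < m)%N ->
             exists2 x, x \in steps & vertex v k.+1 = ((vertex v k + x) %% n)%N)
          (allowed arrow v).
Proof.
apply: (iffP (allowedP _ _)) => av k /av.
  by case/hasP => x xs /eqP; exists x.
by case=> x xs e; apply/hasP; exists x => //; apply/eqP.
Qed.

Lemma mem_steps x : x \in steps -> (0 < x <= s)%N.
Proof. by rewrite !inE => /orP[]/eqP->; lia. Qed.

Lemma nth_steps d k : all (mem steps) d -> (k < size d)%N -> nth 0%N d k \in steps.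
Proof. by move=> /all_nthP; apply. Qed.

Lemma allowed_step_path m a d :
  size d = m -> all (mem steps) d -> allowed arrow (step_path N m a d).
Proof.
move=> <- dS; apply/allowed_stepP=> k km; exists (nth 0%N d k); first exact: nth_steps.
exact: vertex_step_pathS.
Qed.

(** The word is read off the vertices: the letter is 1 where adding 1 gives the next vertex, and [s]
    otherwise. *)
Lemma allowed_ex m (v : epath n m) : allowed arrow v ->
  exists (a : 'I_n) d, [/\ size d = m, all (mem steps) d & v = step_path N m a d].
Proof.
move=> /allowed_stepP av.
pose d := mkseq (fun k => if vertex v k.+1 == ((vertex v k + 1) %% n)%N then 1%N else s) m.
exists (v (inord 0)), d; split; first by rewrite size_mkseq.
  by apply/allP=> _ /mapP[k _ ->]; case: ifP => _; rewrite !inE eqxx ?orbT.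
apply: vertex_inj; elim=> [|k IHk] km.
  by rewrite vertex_step_path // take0 addn0 modn_small ?ltn_vertex.
rewrite vertex_step_pathS // -IHk ?(ltnW km) // nth_mkseq //.
case: eqP => // ne; have [x] := av k km; rewrite !inE => /orP[]/eqP-> //.
Qed.

(** Consecutive vertices of a face differ by one step or by the sum of two, which lies strictly
    between 0 and n because 2s < n. *)
Lemma regular_delv m (v : epath n m.+1) j : allowed arrow v -> regular (delv j v).
Proof.
move=> /allowed_stepP av; apply/regularP=> k km; rewrite !vertex_delv // ?(ltnW km) //.
have Ek : bump j k.+1 = (bump j k).+1 \/ bump j k.+1 = (bump j k).+2.
  by rewrite /bump; lia.
have bk : (bump j k.+1 <= m.+1)%N by rewrite /bump; lia.
have vlt := ltn_vertex v (bump j k).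
case: Ek bk => -> bk.
  have [x /mem_steps xs ->] := av _ bk.
  (* The vertex p is rewritten as (p + 0) mod n, so that cancellation compares 0 with the step. *)
  rewrite -{1}[vertex v _](modn_small vlt) -{1}[vertex v _]addn0 => /eq_modnDl_small; lia.
have [y /mem_steps ys ->] := av _ bk.
have [x /mem_steps xs ->] := av _ (ltnW bk).
rewrite -{1}[vertex v _](modn_small vlt) -{1}[vertex v _]addn0 modnDml -addnA.
move=> /eq_modnDl_small; lia.
Qed.

Lemma ltn_steps x : x \in steps -> (x < n)%N.
Proof. by move=> /mem_steps; lia. Qed.

Lemma ltn_add_steps x y : x \in steps -> y \in steps -> (x + y < n)%N.
Proof. by move=> /mem_steps xS /mem_steps yS; lia. Qed.

(** The sums 2, s + 1 and 2s are distinct, so a sum of two steps determines the unordered pair. *)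
Lemma add_steps_eq x y z t : x \in steps -> y \in steps -> z \in steps -> t \in steps ->
  (x + y = z + t)%N -> z = x \/ z = y.
Proof.
by rewrite !inE => /orP[]/eqP-> /orP[]/eqP-> /orP[]/eqP-> /orP[]/eqP->; lia.
Qed.

(** * The relation on Omega imposed by one face that is not allowed *)

Section Relations.
Variables (m k x y : nat) (v1 v2 : epath n m.+1).
Hypotheses (km : (k < m)%N) (xS : x \in steps) (yS : y \in steps)
  (xyS : (x + y)%N \notin steps) (av1 : allowed arrow v1)
  (vk1 : vertex v1 k.+1 = ((vertex v1 k + x) %% n)%N)
  (vk2 : vertex v1 k.+2 = ((vertex v1 k + (x + y)) %% n)%N)
  (v2k1 : vertex v2 k.+1 = ((vertex v1 k + y) %% n)%N)
  (v21 : forall i, (i <= m.+1)%N -> i != k.+1 -> vertex v2 i = vertex v1 i).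
Let j0 : 'I_m.+2 := Ordinal (ltnW km : k.+1 < m.+2)%N.

Let delv21 : delv j0 v2 = delv j0 v1.
Proof.
apply: vertex_inj => i im; rewrite !vertex_delv // v21 //; last first.
  by rewrite eq_sym (neq_bump k.+1).
by rewrite /=; case: (ltnP i k.+1) => ik; rewrite ?(bump_ltn ik) ?(bump_leq ik) ?ltnS // leqW.
Qed.

Let bump0 : bump k.+1 k = k. Proof. exact: bump_ltn. Qed.
Let bump1 : bump k.+1 k.+1 = k.+2. Proof. exact: bump_leq. Qed.

Let delv_not_allowed : ~~ allowed arrow (delv j0 v1).
Proof.
apply/negP=> /allowed_stepP/(_ k km) [z zS].
rewrite !vertex_delv // ?(ltnW km) //= bump0 bump1 vk2 => /eq_modnDl_small E.
by case/negP: xyS; rewrite E //; [exact: ltn_add_steps | exact: ltn_steps].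
Qed.

(** The face obtained from [v1] by merging the steps [x] and [y] arises from no allowed path except
    [v1] and its swap [v2], and only at the same position. *)
Let delv_eq (v : epath n m.+1) j : allowed arrow v -> delv j v = delv j0 v1 ->
  j = j0 /\ (v == v1) || (v == v2).
Proof.
move=> /allowed_stepP av e.
have eb i : (i <= m)%N -> vertex v (bump j i) = vertex v1 (bump k.+1 i).
  by move=> im; rewrite -!(vertex_delv _ j0) // -e vertex_delv.
have e0 : vertex v (bump j k) = vertex v1 k by rewrite eb ?bump0 // ltnW.
have e2 : vertex v (bump j k.+1) = vertex v1 k.+2 by rewrite eb ?bump1.
have j_j0 : j = j0.
  (* If another vertex were deleted, the ends of the merged step would be adjacent in [v], making
     [x + y] a step. *)
  apply: val_inj; apply/eqP/negPn/negP => /= jk.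
  have [Eb bj] : bump j k.+1 = (bump j k).+1 /\ (bump j k < m.+1)%N.
    move: jk; rewrite neq_ltn => /orP[]; last first.
      by move=> kj; rewrite !bump_ltn ?(ltnW kj) // ltnW.
    by rewrite ltnS => jk; rewrite !bump_leq // ltnW.
  have [z zS] := av _ bj.
  rewrite -Eb e2 e0 vk2 => /eq_modnDl_small E.
  by case/negP: xyS; rewrite E //; [exact: ltn_add_steps | exact: ltn_steps].
split=> //; subst j; move: e0 e2; rewrite /= bump0 bump1 => e0 e2.
(* The two steps of [v] around the deleted vertex sum to [x + y], so the first is [x] or [y]; this
   fixes the missing vertex. *)
have [z zS E1] := av k (ltnW km).
have [t tS] := av k.+1 km.
rewrite e2 E1 e0 modnDml -addnA vk2 => /eq_modnDl_small E.
have zxy : z = x \/ z = y.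
  by apply: (add_steps_eq xS yS zS tS); apply: E; rewrite ltn_add_steps.
have same i : (i <= m.+1)%N -> i != k.+1 -> vertex v i = vertex v1 i.
  rewrite neq_ltn => im /orP[] ik.
    by have := eb i; rewrite /= bump_ltn //; apply; exact: leq_trans (ltnW km).
  case: i ik im => // i ki im.
  by have := eb i im; rewrite /= bump_leq.
apply/orP; case: zxy => zE; [left | right]; apply/eqP/vertex_inj => i im.
  have [->|/same -> //] := eqVneq i k.+1.
  by rewrite E1 e0 vk1 zE.
have [->|ik] := eqVneq i k.+1; last by rewrite same // v21.
by rewrite E1 e0 v2k1 zE.
Qed.

(** The coefficient of the boundary at this face is, up to sign, the sum of [u] over the paths
    having it as a face. When [x = y] the paths [v1] and [v2] coincide and one term remains. *)
Lemma Omega_relation (u : chain K n m.+1) : u \in Omega K arrow m.+1 ->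
  u v1 + (if x == y then 0 else u v2) = 0.
Proof.
rewrite memv_OmegaS => /andP[/AspaceP uA /AspaceP /(_ _ delv_not_allowed)].
rewrite bdryE; last exact: regular_delv.
have inner v : \sum_(j < m.+2) (if delv j v == delv j0 v1 then (-1) ^+ j * u v else 0) =
    if (v == v1) || (v == v2) then (-1) ^+ j0 * u v else 0.
  have [av|nav] := boolP (allowed arrow v); last first.
    by rewrite (uA v nav) mulr0 if_same big1 // => j _; rewrite mulr0 if_same.
  case: ifP => v12.
    rewrite (bigD1 j0) //= big1 ?addr0 => [|j jj0].
      by case/orP: v12 => /eqP->; rewrite ?delv21 eqxx.
    by case: eqP => // /(delv_eq av)[e]; rewrite e eqxx in jj0.
  by apply: big1 => j _; case: eqP => // /(delv_eq av)[_]; rewrite v12.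
rewrite (eq_bigr _ (fun v _ => inner v)) -big_mkcond (bigD1 v1) ?eqxx //=.
have [xy|xy] := eqVneq x y.
  have -> : v2 = v1.
    apply: vertex_inj => i im; have [->|/v21->//] := eqVneq i k.+1.
    by rewrite v2k1 vk1 xy.
  rewrite big1 => [|v]; last by rewrite orbb andbN.
  by rewrite !addr0 => /eqP; rewrite mulf_eq0 signr_eq0 => /eqP.
have v12 : v2 != v1.
  apply: contraNneq xy => v12; move: v2k1; rewrite v12 vk1.
  by move=> /eq_modnDl_small->//; exact: ltn_steps.
rewrite (bigD1 v2) ?eqxx ?orbT //= big1 => [|v].
  by rewrite addr0 -mulrDr => /eqP; rewrite mulf_eq0 signr_eq0 => /eqP.
by case: (v == v1); case: (v == v2).
Qed.

End Relations.

(** The relation in terms of words: unequal letters give antisymmetry, equal letters give a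
    vanishing coefficient. *)
Lemma Omega_swap m (u : chain K n m.+1) a d1 d2 x y :
  u \in Omega K arrow m.+1 -> (size d1 + size d2).+1 = m ->
  all (mem steps) d1 -> all (mem steps) d2 -> x \in steps -> y \in steps ->
  (x + y)%N \notin steps ->
  u (step_path N m.+1 a (d1 ++ [:: x, y & d2])) +
    (if x == y then 0 else u (step_path N m.+1 a (d1 ++ [:: y, x & d2]))) = 0.
Proof.
move=> uO dm d1S d2S xS yS xyS.
have km : (size d1 < m)%N by rewrite -dm ltnS leq_addr.
have nth0 z z' : nth 0%N (d1 ++ [:: z, z' & d2]) (size d1) = z.
  by rewrite nth_cat ltnn subnn.
have nth1 z z' : nth 0%N (d1 ++ [:: z, z' & d2]) (size d1).+1 = z'.
  by rewrite nth_cat ltnNge leqnSn subSnn.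
(* The two words have the same partial sums except at length [(size d1).+1]. *)
have v21 i : (i <= m.+1)%N -> i != (size d1).+1 ->
    vertex (step_path N m.+1 a (d1 ++ [:: y, x & d2])) i =
    vertex (step_path N m.+1 a (d1 ++ [:: x, y & d2])) i.
  move=> im ik; rewrite !vertex_step_path //; congr ((a + _) %% _)%N.
  rewrite !take_cat; case: ltnP => // kd1; rewrite !sumn_cat; congr (_ + _)%N.
  case E: (i - size d1)%N ik => [|[|l]] //=; last by rewrite addnCA.
  by rewrite -(subnK kd1) E eqxx.
have kd1 : size d1 != (size d1).+1 by rewrite neq_ltn leqnn.
have ltkm : (size d1 < m.+1)%N by rewrite ltnW.
apply: (Omega_relation (k := size d1)) => //.
- apply: allowed_step_path; first by rewrite size_cat /= !addnS dm.
  by rewrite all_cat /= d1S d2S xS yS.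
- by rewrite vertex_step_pathS // nth0.
- by rewrite vertex_step_pathS // nth1 vertex_step_pathS // nth0 modnDml addnA.
- by rewrite vertex_step_pathS // nth0 v21 // ltnW.
Qed.

(** * Boundaries in low degree and the homology in degree 0 *)

Local Notation P := (step_path N).
Local Notation e := (epath_vec K).

Lemma step_path_mod m a d : P m (a %% n) d = P m a d.
Proof. by apply: vertex_inj => k km; rewrite !vertex_step_path // modnDml. Qed.

Lemma step_path_inj m a b d d' : (a < n)%N -> (b < n)%N ->
  size d = m -> size d' = m -> all (mem steps) d -> all (mem steps) d' ->
  P m a d = P m b d' -> a = b /\ d = d'.
Proof.
move=> an bn dm d'm dS d'S eP.
have eV k : vertex (P m a d) k = vertex (P m b d') k by rewrite eP.
split; first by have := eV 0%N; rewrite !vertex_step_path // !take0 !addn0 !modn_small.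
apply: (@eq_from_nth _ 0%N) => [|k]; rewrite dm ?d'm // => km.
have := eV k.+1; rewrite !vertex_step_pathS // eV => /eq_modnDl_small; apply.
  by apply/ltn_steps/nth_steps; rewrite ?dm.
by apply/ltn_steps/nth_steps; rewrite ?d'm.
Qed.

Lemma bdry_step1 a x :
  bdry K n 0 (e (P 1 a [:: x])) = e (P 0 (a + x) [::]) - e (P 0 a [::]).
Proof.
rewrite bdry_epath => [|j]; last by apply/regularP.
rewrite !big_ord_recl big_ord0 addr0 expr0 scale1r expr1 scaleN1r.
by congr (e _ - e _); apply: vertex_inj => -[|//] _;
  rewrite vertex_delv // !vertex_step_path //= ?addn0.
Qed.

Lemma bdry_step2 a x y : x \in steps -> y \in steps ->
  bdry K n 1 (e (P 2 a [:: x; y])) =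
    e (P 1 (a + x) [:: y]) - e (P 1 a [:: (x + y)%N]) + e (P 1 a [:: x]).
Proof.
move=> xS yS; rewrite bdry_epath => [|j]; last first.
  by apply: regular_delv; apply: allowed_step_path; rewrite //= xS yS.
rewrite !big_ord_recl big_ord0 addr0 expr0 scale1r expr1 scaleN1r sqrrN expr1n scale1r addrA.
by congr (e _ - e _ + e _); apply: vertex_inj => -[|[|//]] _;
  rewrite vertex_delv // !vertex_step_path //= ?addn0 ?addnA.
Qed.

Definition one_step (i : 'I_n * bool) : epath n 1 := P 1 i.1 [:: if i.2 then 1%N else s].

Lemma mem_step_if (b : bool) : (if b then 1%N else s) \in steps.
Proof. by case: b; rewrite !inE eqxx ?orbT. Qed.

Lemma allowed1 v : allowed arrow v -> exists i, v = one_step i.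
Proof.
case/allowed_ex => a [d [d1 dS ->]]; case: d d1 dS => [//|x [|//]] _ /= /andP[+ _]; rewrite !inE.
by case/orP=> /eqP->; [exists (a, true) | exists (a, false)].
Qed.

Lemma dim_Omega1 : \dim (Omega K arrow 1) = n.*2.
Proof.
have card_I : #|{: 'I_n * bool}| = n.*2 by rewrite card_prod card_ord card_bool muln2.
rewrite Omega1 -card_I; apply/eqP; rewrite eqn_leq; apply/andP; split.
  apply: (@dim_le_eval _ _ _ one_step) => u /AspaceP uA u0; apply/ffunP=> v; rewrite ffunE.
  by have [/allowed1[i ->]|/uA] := boolP (allowed arrow v).
apply: (@dim_ge_eval _ _ _ one_step _ (fun i => e (one_step i)) 1); rewrite ?oner_eq0 //.
  by move=> i; apply/epath_vec_Aspace/allowed_step_path; rewrite //= mem_step_if.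
move=> [a b] [a' b']; rewrite ffunE mul1r; congr (_%:R); congr nat_of_bool.
apply/eqP/eqP => [/step_path_inj|[-> ->] //] /=; rewrite !mem_step_if.
case=> // /val_inj-> []; case: b b' => [] [] //; lia.
Qed.

(** The augmentation of the complex. *)
Definition total (u : chain K n 0) : K^o := \sum_v u v.

Lemma total_is_linear : linear total.
Proof.
move=> c u v; rewrite /total scaler_sumr -big_split; apply: eq_bigr => w _.
by rewrite !ffunE.
Qed.

HB.instance Definition _ := GRing.isLinear.Build K (chain K n 0) K^o _ total total_is_linear.

Lemma total_epath v : total (e v) = 1.
Proof.
rewrite /total (bigD1 v) //= ffunE eqxx big1 ?addr0 // => w /negPf wv.
by rewrite ffunE wv.
Qed.

Lemma epath0_eq (v : epath n 0) : v = P 0 (vertex v 0) [::].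
Proof.
by apply: vertex_inj => -[|//] _; rewrite vertex_step_path //= addn0 modn_small ?ltn_vertex.
Qed.

Lemma one_step_Omega a x : x \in steps -> e (P 1 a [:: x]) \in Omega K arrow 1.
Proof. by move=> xS; rewrite Omega1 epath_vec_Aspace // allowed_step_path //= xS. Qed.

Lemma steps1 : 1%N \in steps. Proof. by rewrite !inE. Qed.
Lemma stepss : s \in steps. Proof. by rewrite !inE eqxx orbT. Qed.

(** Upper bound: boundaries lie in the kernel of the augmentation, which is nonzero on a vertex.
    Lower bound: arrows of step 1 make every vertex homologous to vertex 0, so one line complements
    the boundaries. *)
Lemma dim_boundaries0 : (\dim (boundaries K arrow 0)).+1 = n.
Proof.
apply/eqP; rewrite eqn_leq; apply/andP; split.
  rewrite -[X in (_ <= X)%N](dim_Omega0 K arrow) -(limg_ker_dim (linfun total) (Omega K arrow 0)).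
  rewrite -addn1 leq_add //.
    apply: dimvS; apply/subvP=> _ /memv_imgP[u uO ->].
    rewrite memv_cap memv_ker /Omega Aspace0 memvf lfunE /=.
    move: uO; rewrite Omega1 => /AspaceP uA.
    rewrite [u]chain_sum !linear_sum big1 // => v _; rewrite !linearZ /=.
    have [/allowed1[i ->]|/uA->] := boolP (allowed arrow v); last by rewrite scale0r.
    rewrite bdry_step1 linearB /= !total_epath subrr; exact: scaler0.
  rewrite lt0n dimv_eq0 -subv0; apply/negP=> /subvP/(_ (total (e (P 0 0 [::])))).
  rewrite memv0 total_epath oner_eq0 => H; suff : false by []; apply: H.
  by rewrite -(total_epath (P 0 0 [::])) -lfunE memv_img // /Omega Aspace0 memvf.
have sub : (fullv <= boundaries K arrow 0 + <[e (P 0 0 [::])]>)%VS.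
  apply/subvP=> u _; rewrite [u]chain_sum; apply: memv_suml => v _; apply: memvZ.
  rewrite (epath0_eq v); elim: (vertex v 0) => [|k IHk].
    by apply: subvP (memv_line _); apply: addvSr.
  have -> : e (P 0 k.+1 [::]) = bdry K n 0 (e (P 1 k [:: 1%N])) + e (P 0 k [::]).
    by rewrite bdry_step1 addn1 subrK.
  apply: memvD => //; apply: (subvP (addvSl _ _)); apply: memv_img.
  exact: one_step_Omega steps1.
have := leq_trans (dimvS sub) (leq_of_leqif (dimv_add_leqif _ _)).
rewrite dim_vline -[X in (X <= _)%N](congr1 (fun U => \dim U) (Aspace0 K arrow)).
rewrite (dim_Omega0 K arrow); case: (_ != 0) => /=; lia.
Qed.

Lemma betti0 : path_betti K arrow 0 = 1%N.
Proof. by rewrite /path_betti /cycles dim_Omega0 -[X in (X - _)%N]dim_boundaries0 subSnn. Qed.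

Lemma dim_cycles1 : \dim (cycles K arrow 1) = n.+1.
Proof.
by have := dim_cycles K arrow 0; rewrite dim_Omega1; have := dim_boundaries0; lia.
Qed.

(** Translation by [x] permutes the starting points; this is what makes sums over all translates
    cycles. *)
Lemma sum_start m d x (F : epath n m -> chain K n m) :
  \sum_(a < n) F (P m (a + x) d) = \sum_(a < n) F (P m a d).
Proof.
rewrite [RHS](reindex_inj (addIr (inZp x))) /=; apply: eq_bigr => a _; congr F.
by rewrite -step_path_mod -[RHS]step_path_mod modn_mod modnDmr.
Qed.

(** * The case where s is not 2 *)

Section StepNotTwo.
Hypothesis s_neq2 : s != 2%N.

Lemma add_steps x y : x \in steps -> y \in steps -> (x + y)%N \notin steps.
Proof. by rewrite !inE => /orP[]/eqP-> /orP[]/eqP->; lia. Qed.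

(** Among the first three letters two agree. If they are adjacent the coefficient vanishes at once;
    otherwise swapping the first two letters makes them adjacent. *)
Lemma Omega3_eq0 m : Omega K arrow m.+3 = 0%VS.
Proof.
apply/eqP; rewrite -subv0; apply/subvP=> u uO; rewrite memv0.
have /AspaceP uA : u \in Aspace K arrow m.+3 by move: uO; rewrite memv_OmegaS => /andP[].
apply/eqP/ffunP=> v; rewrite ffunE.
have [|/uA//] := boolP (allowed arrow v).
case/allowed_ex=> a [d0 [sz + ->]]; case: d0 sz => [|x [|y [|z d]]] //= [dm].
case/and4P=> xS yS zS dS.
have := Omega_swap (d1 := [::]) (d2 := z :: d) a uO _ _ _ xS yS (add_steps xS yS).
rewrite /= zS dS dm => /(_ erefl isT isT).
have [_|xy] := eqVneq x y; first by rewrite addr0.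
have [xz|xz] := eqVneq x z.
  have := Omega_swap (d1 := [:: y]) (d2 := d) a uO _ _ _ xS zS (add_steps xS zS).
  by rewrite /= yS dS dm xz eqxx addr0 => /(_ erefl isT isT)->; rewrite addr0.
have yz : y = z.
  by move: xS yS zS xy xz; rewrite !inE => /orP[]/eqP-> /orP[]/eqP-> /orP[]/eqP->; rewrite ?eqxx.
have := Omega_swap (d1 := [:: x]) (d2 := d) a uO _ _ _ yS zS (add_steps yS zS).
by rewrite /= xS dS dm yz eqxx addr0 => /(_ erefl isT isT)->.
Qed.

Definition square (a : nat) : chain K n 2 := e (P 2 a [:: 1%N; s]) - e (P 2 a [:: s; 1%N]).

Lemma bdry_square a : bdry K n 1 (square a) =
  (e (P 1 (a + 1) [:: s]) - e (P 1 a [:: s])) - (e (P 1 (a + s) [:: 1%N]) - e (P 1 a [:: 1%N])).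
Proof.
rewrite linearB /= !bdry_step2 ?steps1 ?stepss // [(s + 1)%N]addnC.
set A := e _; set B := e _; set C := e _; set D := e _; set E := e _.
rewrite !opprD !opprK !addrA.
(* The faces along 1 + s, which are terms 2 and 5, are brought together and cancel. *)
by rewrite [LHS](ACl (1*6*4*3*(2*5))) /= addNr addr0.
Qed.

Lemma square_Omega a : square a \in Omega K arrow 2.
Proof.
have aS x y : x \in steps -> y \in steps -> e (P 2 a [:: x; y]) \in Aspace K arrow 2.
  by move=> xS yS; rewrite epath_vec_Aspace // allowed_step_path //= xS yS.
rewrite memv_OmegaS memvB ?aS ?steps1 ?stepss //= bdry_square -Omega1.
by rewrite memvB // memvB // one_step_Omega ?steps1 ?stepss.
Qed.

Lemma square_eval (a b : 'I_n) : square a (P 2 b [:: 1%N; s]) = (a == b)%:R.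
Proof.
rewrite !ffunE [X in _ - X](_ : _ = 0) ?subr0; last first.
  case: eqP => // /step_path_inj[]; rewrite /= ?steps1 ?stepss // => _ []; lia.
congr (_%:R); congr nat_of_bool; apply/eqP/eqP => [/step_path_inj[]|->//].
all: rewrite /= ?steps1 ?stepss //.
by move=> /val_inj.
Qed.

(** Coefficients of words with equal letters vanish, and that of [s, 1] is minus that of [1, s]. *)
Lemma Omega2_eval0 u : u \in Omega K arrow 2 ->
  (forall a : 'I_n, u (P 2 a [:: 1%N; s]) = 0) -> u = 0.
Proof.
move=> uO u0; have /AspaceP uA : u \in Aspace K arrow 2 by move: uO; rewrite memv_OmegaS => /andP[].
apply/ffunP=> v; rewrite ffunE.
have [|/uA//] := boolP (allowed arrow v).
case/allowed_ex=> a [d [d2 dS ->]]; case: d d2 dS => [|x [|y [|]]] //= _ /and3P[xS yS _].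
have := Omega_swap (d1 := [::]) (d2 := [::]) a uO erefl isT isT xS yS (add_steps xS yS).
have [_|] := eqVneq x y; first by rewrite addr0.
move: xS yS; rewrite !inE => /orP[]/eqP-> /orP[]/eqP->; rewrite ?eqxx //= u0 ?addr0 //.
Qed.

Lemma Omega2_sum u : u \in Omega K arrow 2 ->
  u = \sum_(a < n) u (P 2 a [:: 1%N; s]) *: square a.
Proof.
move=> uO; apply/eqP; rewrite -subr_eq0; apply/eqP/Omega2_eval0 => [|b].
  by apply: memvB => //; apply: memv_suml => a _; apply/memvZ/square_Omega.
rewrite !ffunE sum_ffunE (bigD1 b) //= big1 ?addr0 => [|a /negPf ab].
  by rewrite ffunE square_eval eqxx /GRing.scale /= mulr1 subrr.
by rewrite ffunE square_eval ab scaler0.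
Qed.

Lemma dim_Omega2 : \dim (Omega K arrow 2) = n.
Proof.
apply/eqP; rewrite eqn_leq -[X in (_ <= X)%N && _](card_ord n).
rewrite -[X in _ && (X <= _)%N](card_ord n); apply/andP; split.
  exact: dim_le_eval Omega2_eval0.
apply: (dim_ge_eval (f := fun a : 'I_n => P 2 a [:: 1%N; s]) (oner_neq0 K)).
  by move=> a; apply: (square_Omega a).
by move=> a b; rewrite square_eval mul1r.
Qed.

(** An arrow of step [s] bounds two neighbouring squares with opposite signs. Using the arrow at
    [k.+1] avoids a predecessor mod n. *)
Lemma bdry_square_eval (a : 'I_n) k :
  bdry K n 1 (square a) (P 1 k.+1 [:: s]) =
    (a == inZp k)%:R - (a == inZp k.+1)%:R.
Proof.
have E1 (b c : nat) : (P 1 b [:: s] == P 1 c [:: s]) = (b == c %[mod n])%N.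
  rewrite -(step_path_mod 1 b) -(step_path_mod 1 c).
  apply/eqP/eqP => [/step_path_inj[]|->//]; rewrite ?ltn_pmod //= stepss //.
have E2 (b c : nat) : (P 1 b [:: s] == P 1 c [:: 1%N]) = false.
  rewrite -(step_path_mod 1 b) -(step_path_mod 1 c).
  apply/eqP => /step_path_inj[]; rewrite ?ltn_pmod //= ?steps1 ?stepss // => _ []; lia.
have E3 l : (a == inZp l) = (l == a %[mod n])%N.
  by rewrite -val_eqE /= eq_sym [X in _ = (_ == X)]modn_small.
by rewrite bdry_square !ffunE !E1 !E2 !subr0 !E3 -[k.+1 in X in X - _ = _]addn1 eqn_modDr.
Qed.

(** A cycle has constant coefficients on the squares, so its value at 0 determines it; conversely
    the sum of all squares is a nonzero cycle, geometrically a torus. *)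
Lemma dim_cycles2 : \dim (cycles K arrow 2) = 1%N.
Proof.
apply/eqP; rewrite eqn_leq; apply/andP; split.
  rewrite -[X in (_ <= X)%N]card_unit; apply: (dim_le_eval (f := fun _ : unit => P 2 0 [:: 1%N; s])) => u.
  rewrite memv_cap memv_ker => /andP[uO /eqP bu] /(_ tt) u0; apply: Omega2_eval0 => // a.
  (* The boundary coefficient at the arrow [(k.+1; s)] compares the squares at [k] and [k.+1]. *)
  have uS k : u (P 2 k.+1 [:: 1%N; s]) = u (P 2 k [:: 1%N; s]).
    move/ffunP/(_ (P 1 k.+1 [:: s])): bu.
    rewrite [X in bdry _ _ _ X](Omega2_sum uO) linear_sum sum_ffunE ffunE.
    under eq_bigr => b _ do rewrite linearZ ffunE bdry_square_eval /GRing.scale /= mulrBr.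
    have pick l : \sum_(b < n) u (P 2 b [:: 1%N; s]) * (b == inZp l)%:R = u (P 2 l [:: 1%N; s]).
      rewrite (bigD1 (inZp l)) //= eqxx mulr1 big1 ?addr0 => [|b /negPf->]; last by rewrite mulr0.
      by rewrite step_path_mod.
    by rewrite sumrB !pick => /eqP; rewrite subr_eq0 => /eqP.
  by elim: (nat_of_ord a) => // k; rewrite uS.
rewrite lt0n dimv_eq0 -subv0; apply/negP=> /subvP/(_ (\sum_(a < n) square a)).
rewrite memv_cap memv_suml /= => [|a _]; last exact: square_Omega.
have -> /= : \sum_(a < n) square a \in lker (bdry K n 1).
  rewrite memv_ker linear_sum (eq_bigr _ (fun (a : 'I_n) _ => bdry_square a)).
  by rewrite !sumrB (sum_start _ 1 (fun v => e v)) (sum_start _ s (fun v => e v)) !subrr.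
move=> /(_ isT); rewrite memv0 => /eqP/ffunP/(_ (P 2 (ord0 : 'I_n) [:: 1%N; s])).
rewrite sum_ffunE (bigD1 ord0) // square_eval eqxx ffunE big1 => [/eqP|a /negPf a0].
  by rewrite /= addr0 (negPf (oner_neq0 K)).
by rewrite square_eval a0.
Qed.

(** The boundaries have dimension n - 1 in degree 1 and 0 from degree 2 on, against cycles of
    dimension n + 1 in degree 1 and 1 in degree 2. *)
Lemma betti_neq2 : [/\ path_betti K arrow 1 = 2%N, path_betti K arrow 2 = 1%N &
  forall m, (3 <= m)%N -> path_betti K arrow m = 0%N].
Proof.
have b3 m : boundaries K arrow m.+2 = 0%VS by rewrite /boundaries Omega3_eq0 limg0.
split=> [||[|[|[|m]]] // _].
- rewrite /path_betti dim_cycles1.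
  by have := dim_cycles K arrow 1; rewrite dim_cycles2 dim_Omega2; lia.
- by rewrite /path_betti dim_cycles2 b3 dimv0.
- by rewrite /path_betti b3 dimv0 subn0; apply/eqP; rewrite /cycles Omega3_eq0 cap0v dimv0.
Qed.

End StepNotTwo.

(** * The case s = 2 *)

Section StepTwo.
Hypothesis s_eq2 : s = 2%N.

Lemma nseq_rcons_cat (T : Type) k (x : T) d : nseq k x ++ x :: d = nseq k.+1 x ++ d.
Proof. by elim: k => //= k ->. Qed.

(** As 1 + 2 is not a step, moving a 2 leftward past the ones only changes the sign of the
    coefficient. *)
Lemma Omega_pull_two m (u : chain K n m.+1) a d0 k d :
  u \in Omega K arrow m.+1 -> (size d0 + k + size d)%N = m ->
  all (mem steps) d0 -> all (mem steps) d ->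
  u (P m.+1 a (d0 ++ s :: nseq k 1%N ++ d)) = 0 ->
  u (P m.+1 a (d0 ++ nseq k 1%N ++ s :: d)) = 0.
Proof.
move=> uO + d0S; elim: k d => [//|k IHk] d sz dS u0.
have d1S : all (mem steps) (d0 ++ nseq k 1%N) by rewrite all_cat d0S all_nseq /= steps1 orbT.
have d1sz : (size (d0 ++ nseq k 1%N) + size d).+1 = m by rewrite size_cat size_nseq -sz addnS.
have S3 : (1 + s)%N \notin steps by rewrite s_eq2.
have := Omega_swap a uO d1sz d1S dS steps1 stepss S3.
rewrite -!catA nseq_rcons_cat (IHk (1%N :: d)) ?if_same ?addr0 //=.
  by rewrite -sz !addnS addSn.
by rewrite nseq_rcons_cat.
Qed.

Lemma steps_split d : all (mem steps) d ->
  d = nseq (size d) 1%N \/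
  exists k d', d = nseq k 1%N ++ s :: d' /\ all (mem steps) d'.
Proof.
elim: d => [|x d IHd] /=; first by left.
case/andP=> xS dS; move: xS; rewrite !inE => /orP[]/eqP->; last by right; exists 0%N, d.
case: (IHd dS) => [{1}->|[k [d' [-> d'S]]]]; first by left.
by right; exists k.+1, d'.
Qed.

(** A word containing a 2 is reduced to one starting with 2. If a second 2 occurs, it is pulled next
    to the first, and the pair is killed because 2 + 2 is not a step. *)
Lemma Omega_eval0 m (u : chain K n m.+1) : u \in Omega K arrow m.+1 ->
  (forall a : 'I_n, u (P m.+1 a (nseq m.+1 1%N)) = 0) ->
  (forall a : 'I_n, u (P m.+1 a (s :: nseq m 1%N)) = 0) -> u = 0.
Proof.
move=> uO u1 u2.
have /AspaceP uA : u \in Aspace K arrow m.+1 by move: uO; rewrite memv_OmegaS => /andP[].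
apply/ffunP=> v; rewrite ffunE.
have [|/uA//] := boolP (allowed arrow v).
case/allowed_ex=> a [d [sz dS ->]].
case: (steps_split dS) sz => [->|[k [d' [-> d'S]]]]; first by rewrite size_nseq => ->.
rewrite size_cat size_nseq /= addnS => -[sz].
apply: (Omega_pull_two (d0 := [::])) => //=.
have d1S : all (mem steps) (nseq k 1%N ++ d') by rewrite all_cat all_nseq /= steps1 orbT.
have d1sz : size (nseq k 1%N ++ d') = m by rewrite size_cat size_nseq.
case: (steps_split d1S) d1sz => [->|[l [d3 [-> d3S]]]]; first by rewrite size_nseq => ->.
rewrite size_cat size_nseq /= addnS => szm.
have sS : all (mem steps) [:: s] by rewrite /= stepss.
have szl : (size [:: s] + l + size d3)%N = m by rewrite -szm.
apply: (Omega_pull_two uO szl sS d3S); rewrite /=.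
have ssS : (s + s)%N \notin steps by rewrite s_eq2.
have := Omega_swap (d1 := [::]) (d2 := nseq l 1%N ++ d3) a uO _ _ _ stepss stepss ssS.
by rewrite eqxx addr0; apply; rewrite //= ?all_cat ?all_nseq ?d3S /= ?steps1 ?orbT ?size_cat ?size_nseq.
Qed.

Lemma dim_Omega_le m : (\dim (Omega K arrow m.+1) <= n.*2)%N.
Proof.
have <- : #|{: 'I_n * bool}| = n.*2 by rewrite card_prod card_ord card_bool muln2.
pose f (i : 'I_n * bool) := P m.+1 i.1 (if i.2 then nseq m.+1 1%N else s :: nseq m 1%N).
apply: (dim_le_eval (f := f)) => u uO u0; apply: Omega_eval0 => // a.
  exact: (u0 (a, true)).
exact: (u0 (a, false)).
Qed.

Definition ones m a := P m a (nseq m 1%N).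

Lemma vertex_ones m a k : (k <= m)%N -> vertex (ones m a) k = ((a + k) %% n)%N.
Proof.
by move=> km; rewrite vertex_step_path // take_nseq // sumn_nseq mul1n.
Qed.

Lemma allowed_ones m a : allowed arrow (ones m a).
Proof. by rewrite allowed_step_path ?size_nseq // all_nseq /= steps1 orbT. Qed.

(** Deleting an inner vertex merges 1 + 1 into the step 2, and deleting an end vertex leaves only
    ones. *)
Lemma allowed_delv_ones m a (j : 'I_m.+2) : allowed arrow (delv j (ones m.+1 a)).
Proof.
apply/allowed_stepP => k km; rewrite !vertex_delv ?(ltnW km) // !vertex_ones; last first.
- by rewrite /bump; lia.
- by rewrite /bump; lia.
have [E|E] : bump j k.+1 = (bump j k + 1)%N \/ bump j k.+1 = (bump j k + s)%N.
  by rewrite /bump; lia.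
  by exists 1%N; rewrite ?steps1 // E modnDml addnA.
by exists s; rewrite ?stepss // E modnDml addnA.
Qed.

Lemma ones_Omega m a : e (ones m a) \in Omega K arrow m.
Proof.
case: m => [|m]; first by rewrite /Omega Aspace0 memvf.
rewrite memv_OmegaS epath_vec_Aspace ?allowed_ones //=.
rewrite bdry_epath => [|j]; last by apply/regular_delv/allowed_ones.
by apply: memv_suml => j _; apply/memvZ/epath_vec_Aspace/allowed_delv_ones.
Qed.

(* Only deleting the second vertex yields a path whose first step is 2. *)
Lemma delv_ones_eq m (a b : 'I_n) (j : 'I_m.+3) :
  delv j (ones m.+2 a) = delv (lift ord0 ord0) (ones m.+2 b) -> j = 1%N :> nat /\ a = b.
Proof.
move=> E; have E0 : vertex (delv j (ones m.+2 a)) 0 = b.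
  by rewrite E vertex_delv // vertex_ones // /bump /= !addn0 modn_small.
have E1 : vertex (delv j (ones m.+2 a)) 1 = ((b + 2) %% n)%N.
  by rewrite E vertex_delv // vertex_ones.
move: E0 E1; rewrite !vertex_delv // !vertex_ones; last first.
- by rewrite /bump; lia.
- by rewrite /bump; lia.
have an := ltn_ord a; rewrite /bump; case: (nat_of_ord j) => [|[|i]] /= E0.
- rewrite -E0 modnDml -addnA => /eq_modnDl_small; lia.
- by split=> //; apply: val_inj; rewrite /= -E0 !addn0 modn_small.
have /val_inj-> : nat_of_ord a = b by rewrite -E0 !addn0 modn_small.
move=> /eq_modnDl_small; lia.
Qed.

(** Evaluated at the faces starting with a step 2, the boundaries of the all-ones paths form minus
    the identity matrix; the sign is that of the second face. *)
Lemma dim_boundaries_ge m : (n <= \dim (boundaries K arrow m.+1))%N.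
Proof.
rewrite -[X in (X <= _)%N](card_ord n).
apply: (dim_ge_eval (f := fun b : 'I_n => delv (lift ord0 ord0) (ones m.+2 b))
  (g := fun a : 'I_n => bdry K n m.+1 (e (ones m.+2 a))) (c := -1)).
- by rewrite oppr_eq0 oner_neq0.
- by move=> a; apply/memv_img/ones_Omega.
move=> a b; rewrite bdry_epath => [|j]; last by apply/regular_delv/allowed_ones.
rewrite sum_ffunE (bigD1 (lift ord0 ord0)) //= big1 => [|j j1].
  rewrite addr0 !ffunE expr1 /GRing.scale /=; congr (_ * _%:R); congr nat_of_bool.
  by apply/eqP/eqP => [/esym/delv_ones_eq[]|->].
rewrite !ffunE; case: eqP => [E|]; last by rewrite scaler0.
have [jE _] := delv_ones_eq (esym E).
by case/eqP: j1; apply: val_inj; exact: jE.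
Qed.

(** Cycles have dimension at most 2n - n = n, and boundaries at least n, so the truncated difference
    is 0. *)
Lemma betti_eq0 m : (2 <= m)%N -> path_betti K arrow m = 0%N.
Proof.
case: m => [|[|m]] // _; rewrite /path_betti.
have := dim_cycles K arrow m.+1; have := dim_Omega_le m.+1.
have := dim_boundaries_ge m; have := dim_boundaries_ge m.+1; lia.
Qed.

(* The step is [vertex v 1 - vertex v 0] mod n; adding [n] avoids truncated subtraction. *)
Definition winding (u : chain K n 1) : K^o :=
  \sum_v u v * ((vertex v 1 + (n - vertex v 0)) %% n)%:R.

Lemma winding_is_linear : linear winding.
Proof.
move=> c u v; rewrite /winding scaler_sumr -big_split; apply: eq_bigr => w _.
by rewrite !ffunE mulrDl scalerAl.
Qed.

HB.instance Definition _ :=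
  GRing.isLinear.Build K (chain K n 1) K^o _ winding winding_is_linear.

Lemma winding_step a x : (x < n)%N -> winding (e (P 1 a [:: x])) = x%:R.
Proof.
move=> xn; rewrite /winding (bigD1 (P 1 a [:: x])) //= ffunE eqxx mul1r big1 ?addr0.
  rewrite !vertex_step_path //= !addn0; congr (_%:R).
  have an := ltn_pmod a (ltn0Sn N).
  rewrite modnDml -addnA -modnDml.
  have -> : (a %% n + (x + (n - a %% n)) = x + n)%N by move: (a %% n)%N an => r; lia.
  by rewrite modnDr modn_small.
by move=> w /negPf wv; rewrite ffunE wv mul0r.
Qed.

(** Both identities are checked on allowed elementary paths. The second is y - (x + y) + x = 0 in
    the field, the residue of x + y being itself since x + y < n. *)
Lemma Omega2_boundary u : u \in Omega K arrow 2 ->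
  bdry K n 0 (bdry K n 1 u) = 0 /\ winding (bdry K n 1 u) = 0.
Proof.
rewrite memv_OmegaS => /andP[/AspaceP uA _].
suff H v : allowed arrow v ->
    bdry K n 0 (bdry K n 1 (e v)) = 0 /\ winding (bdry K n 1 (e v)) = 0.
  rewrite [u]chain_sum !linear_sum; split; apply: big1 => v _; rewrite !linearZ /=.
    by have [/H[-> _]|/uA->] := boolP (allowed arrow v); rewrite ?scaler0 ?scale0r.
  by have [/H[_ ->]|/uA->] := boolP (allowed arrow v); rewrite ?scaler0 ?scale0r.
case/allowed_ex=> a [d [d2 dS ->]]; case: d d2 dS => [|x [|y [|]]] //= _ /and3P[xS yS _].
rewrite bdry_step2 //; split; last first.
  rewrite linearD linearB /= !winding_step ?ltn_add_steps ?ltn_steps //.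
  by rewrite natrD opprD addrCA subrr addr0 addNr.
rewrite linearD linearB /= !bdry_step1 addnA opprB.
set A := e _; set B := e _; set C := e _.
by rewrite [A - B + _]addrC !subrKA subrr.
Qed.

Hypothesis char0 : [pchar K] =i pred0.

(** Boundaries have dimension at least n and lie in the kernel of [winding] on the cycles, a space
    of dimension n + 1 on which [winding] is nonzero. *)
Lemma betti1_eq2 : path_betti K arrow 1 = 1%N.
Proof.
rewrite /path_betti dim_cycles1.
suff : (\dim (boundaries K arrow 1) < n.+1)%N by have := dim_boundaries_ge 0; lia.
rewrite -dim_cycles1 -(limg_ker_dim (linfun winding) (cycles K arrow 1)) -addn1 leq_add //.
  apply: dimvS; apply/subvP=> _ /memv_imgP[u uO ->].
  have [bb0 wb0] := Omega2_boundary uO.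
  have bO : bdry K n 1 u \in Omega K arrow 1.
    by move: uO; rewrite memv_OmegaS Omega1 => /andP[].
  rewrite 2!memv_cap bO !memv_ker bb0 [linfun winding _]lfunE /= wb0.
  by rewrite !eqxx.
(* The loop once around the circle by steps of 1; its winding is n, nonzero in characteristic 0. *)
pose c : chain K n 1 := \sum_(a < n) e (P 1 a [:: 1%N]).
have cC : c \in cycles K arrow 1.
  rewrite memv_cap memv_suml /= => [|a _]; last exact: one_step_Omega steps1.
  rewrite memv_ker linear_sum (eq_bigr _ (fun (a : 'I_n) _ => bdry_step1 a 1)).
  by rewrite sumrB (sum_start _ 1 (fun v => e v)) subrr.
rewrite lt0n dimv_eq0 -subv0; apply/negP=> /subvP/(_ (winding c)).
rewrite -{1}[winding c]lfunE memv_img // => /(_ isT).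
rewrite memv0 linear_sum (eq_bigr (fun=> 1)) => [|a _]; last first.
  by rewrite /= winding_step ?ltn_steps ?steps1.
by rewrite sumr_const card_ord ((pcharf0P K).1 char0).
Qed.

End StepTwo.

End Circulant.

(** * The Betti numbers in both cases *)

Theorem mainTheorem8 (K : fieldType) (n s : nat) :
  ([pchar K]%R =i pred0) ->
  (5 <= n)%N -> (1 < s)%N -> (s.*2 < n)%N ->
  (s = 2%N ->
     @path_betti K n (@circ_arrow n [:: 1%N; s]) 0 = 1%N /\
     @path_betti K n (@circ_arrow n [:: 1%N; s]) 1 = 1%N /\
     (forall m : nat, (2 <= m)%N -> @path_betti K n (@circ_arrow n [:: 1%N; s]) m = 0%N)) /\
  (s <> 2%N ->
     @path_betti K n (@circ_arrow n [:: 1%N; s]) 0 = 1%N /\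
     @path_betti K n (@circ_arrow n [:: 1%N; s]) 1 = 2%N /\
     @path_betti K n (@circ_arrow n [:: 1%N; s]) 2 = 1%N /\
     (forall m : nat, (3 <= m)%N -> @path_betti K n (@circ_arrow n [:: 1%N; s]) m = 0%N)).
Proof.
case: n => [//|N] char0 _ s_gt1 s_lt; split=> [s2|/eqP s2].
  split; first exact: betti0.
  by split; [exact: betti1_eq2 | exact: betti_eq0].
have [b1 b2 b3] := betti_neq2 K s_gt1 s_lt s2.
by split; first exact: betti0.
Qed.
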